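(* Let $k$ be a positive integer, $(\mathcal{M},+)$ a closed submonoid of $(\mathbb{R}_{\ge 0},+)$ and $N\in\mathcal{M}$ an element. The following quantities all admit the same maximal value: \begin{enumerate} \item the sum $$\sum_{\text{length-}k\text{ paths in }\Gamma}\mathrm{ct}(\text{path}),$$ for $\mathcal{M}$-labeled directed acyclic graphs $\Gamma$ of weight $N$; \item the weight of $A^k$, where $A$ is a nilpotent square $\mathcal{M}$-valued matrix (of arbitrary finite size) of weight $N$; \item the product of $k$ non-negative elements of $\mathcal{M}$ with sum $N$. \end{enumerate}
   Context: All graphs are finite and directed; a directed acyclic graph is one without oriented cycles of any length, including loops. A closed submonoid $\mathcal{M}$ of $(\mathbb{R}_{\ge 0},+)$ is a topologically closed subset containing $0$ and closed under addition. An $\mathcal{M}$-labeled directed graph is a directed graph without repeated edges in which every ordered pair $(x,y)$ of vertices carries a label $\ell(x,y)\in\mathcal{M}$, with $\ell(x,y)=0$ precisely when $(x,y)$ is not an edge. The weight of an $\mathcal{M}$-labeled graph is the sum of the labels of its edges; its content $\mathrm{ct}$ is the product of the labels of its edges, and the content $\mathrm{ct}(\text{path})$ of a path in $\Gamma$ is computed with the labels inherited from $\Gamma$. The length of a path is its number of edges. The weight of a square matrix with non-negative real entries is the sum of all of its entries; powers $A^k$ are computed over $\mathbb{R}$. *)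

(* Defs.v *)
From HB Require Import structures.
From mathcomp Require Import all_boot all_order all_algebra.
From mathcomp Require Import all_classical all_reals all_analysis.

Set Implicit Arguments.
Unset Strict Implicit.
Unset Printing Implicit Defensive.

Import Order.TTheory GRing.Theory Num.Theory.
Import numFieldNormedType.Exports.

Local Open Scope classical_set_scope.
Local Open Scope ring_scope.

Definition closed_submonoid (R : realType) (M : set R) : Prop :=
  [/\ closed M,
      M `<=` [set x | 0 <= x],
      M 0
    & forall x y, M x -> M y -> M (x + y)].

Record labeled_digraph (R : realType) (M : set R) := LabeledDigraph {
  vertex : finType;
  edge : rel vertex;
  label : vertex -> vertex -> R;
  label_in : forall x y, M (label x y);
  label_eq0 : forall x y, (label x y == 0) = ~~ edge x y
}.

(* [cycle] also holds of the empty sequence, and of [:: x] when x has a loop. *)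
Definition acyclic (R : realType) (M : set R) (G : labeled_digraph M) : Prop :=
  forall c : seq (vertex G), c != [::] -> ~~ cycle (@edge _ _ G) c.

Definition graph_weight (R : realType) (M : set R) (G : labeled_digraph M) : R :=
  \sum_(e : vertex G * vertex G | edge e.1 e.2) label e.1 e.2.

(* A path is given by the sequence of its vertices; [zip s (behead s)] lists
   its edges, [zip] dropping the last vertex of [s]. *)
Definition path_content (R : realType) (M : set R) (G : labeled_digraph M)
    (s : seq (vertex G)) : R :=
  \prod_(e <- zip s (behead s)) label e.1 e.2.

(* A path of length k has k edges, hence k.+1 vertices. *)
Definition path_content_sum (R : realType) (M : set R) (k : nat)
    (G : labeled_digraph M) : R :=
  \sum_(p : k.+1.-tuple (vertex G) | sorted (@edge _ _ G) p) path_content p.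

Definition mx_weight (R : realType) (n : nat) (A : 'M[R]_n) : R :=
  \sum_i \sum_j A i j.

Definition nilpotent_mx (R : realType) (n : nat) (A : 'M[R]_n) : Prop :=
  exists m : nat, A ^+ m = 0.

Definition dag_values (R : realType) (M : set R) (N : R) (k : nat) : set R :=
  [set v | exists G : labeled_digraph M,
     [/\ acyclic G, graph_weight G = N & v = path_content_sum k G]].

Definition nilpotent_values (R : realType) (M : set R) (N : R) (k : nat)
    : set R :=
  [set v | exists (n : nat) (A : 'M[R]_n),
     [/\ forall i j, M (A i j), nilpotent_mx A, mx_weight A = N
       & v = mx_weight (A ^+ k)]].

Definition product_values (R : realType) (M : set R) (N : R) (k : nat)
    : set R :=
  [set v | exists x : 'I_k -> R,
     [/\ forall i, M (x i), forall i, 0 <= x i, \sum_i x i = N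
       & v = \prod_i x i]].

Definition is_maximum (R : realType) (S : set R) (v : R) : Prop :=
  S v /\ ubound S v.

(* Main.v *)
Require Import Defs.
From mathcomp Require Import all_boot all_order all_algebra.
From mathcomp Require Import all_classical all_reals all_analysis.
From mathcomp Require Import zify.

(** Why the three maxima agree.

    Nilpotent non-negative matrices are the label matrices of acyclic digraphs,
    the weight of the k-th power being the sum of the contents of the length-k
    paths, and a directed path of k edges shows that every product of k elements
    with sum N is reached by an acyclic digraph of weight N.  The maximum of the
    products exists by compactness.  The point is therefore to bound the path
    sum of an acyclic digraph by one of these products.

    This is done with a random forest.  Let [d v] be the total label of the
    edges entering [v], and let every vertex [v], independently of the others,
    choose a parent [p v], equal to [u] with probability [label u v / d v].  The
    heads of the edges of a path in an acyclic digraph are distinct, so these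
    edges are all chosen with probability equal to the product of the quotients
    [label u v / d v].  Hence the content of a path is the expectation of the
    product of the [d v] over its heads, counted only when the path runs along
    chosen edges ([prod_arcs_expectation]), and the path sum is the expectation
    of the same sum taken in the forest of chosen edges.

    In a forest, colour every vertex by its depth modulo k.  The k heads of a
    length-k path have consecutive depths, hence receive each of the k colours
    once.  Expanding the product over the colours c of the sums
    [y_c = \sum_(v of colour c) d v], every path contributes its own monomial,
    so the path sum of the forest is at most [\prod_c y_c]
    ([down_path_sum_le]).  The [y_c] are sums of labels, hence lie in the monoid,
    and they add up to N: each value of the random variable, and therefore its
    expectation, is at most the maximal product. *)

Set Implicit Arguments.
Unset Strict Implicit.
Unset Printing Implicit Defensive.

Import Order.TTheory GRing.Theory Num.Theory.
Import numFieldNormedType.Exports.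

Local Open Scope ring_scope.

(** * Contents of walks *)

Definition walk_content (R : pzSemiRingType) (V : Type) (A : V -> V -> R)
    (s : seq V) : R :=
  \prod_(e <- zip s (behead s)) A e.1 e.2.

Definition walk_sum (R : pzSemiRingType) (V : finType) (A : V -> V -> R)
    (k : nat) : R :=
  \sum_(t : k.+1.-tuple V) walk_content A t.

Lemma walk_content_cons2 (R : pzSemiRingType) (V : Type) (A : V -> V -> R)
    (x y : V) (s : seq V) :
  walk_content A [:: x, y & s] = A x y * walk_content A (y :: s).
Proof. by rewrite /walk_content /= big_cons. Qed.

Lemma walk_content_ge0 (R : numDomainType) (V : Type) (A : V -> V -> R)
    (s : seq V) :
  (forall u v, 0 <= A u v) -> 0 <= walk_content A s.
Proof. by move=> A_ge0; apply: prodr_ge0 => e _; apply: A_ge0. Qed.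

Lemma sorted_arcs (V : Type) (e : rel V) (s : seq V) :
  sorted e s = all (fun a => e a.1 a.2) (zip s (behead s)).
Proof. by case: s => //= x s; elim: s x => //= y s IHs x; rewrite IHs. Qed.

Lemma arc_heads (V : Type) (s : seq V) : unzip2 (zip s (behead s)) = behead s.
Proof. by apply: unzip2_zip; rewrite size_behead leq_pred. Qed.

Lemma prod_indicator (R : pzSemiRingType) (T : Type) (b : pred T) (s : seq T) :
  \prod_(e <- s) (b e)%:R = (all b s)%:R :> R.
Proof.
elim: s => [|e s IHs]; first by rewrite big_nil.
by rewrite big_cons IHs /=; case: (b e); rewrite ?mul1r ?mul0r.
Qed.

(** * Averaging over random parents *)

Section RandomParent.

Variables (R : comPzRingType) (V : finType) (q : V -> V -> R).
Hypothesis q_sum1 : forall v, \sum_u q v u = 1.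

(** [\prod_v q v (p v)] is the probability of the parent function [p] when the
    vertices choose independently; the choices at distinct heads are then
    independent, so both sides are the probability that all the arcs in [s] are
    chosen. *)
Lemma prod_arcs_expectation (s : seq (V * V)) : uniq (unzip2 s) ->
  \prod_(e <- s) q e.2 e.1 =
    \sum_(p : {ffun V -> V})
       (\prod_v q v (p v)) * (all (fun e => p e.2 == e.1) s)%:R.
Proof.
move=> uniq_heads.
(* Attaching each arc to its head turns the event into a product over [v] of
   conditions on [p v] alone, to which distributivity applies. *)
transitivity
  (\prod_v \sum_u q v u * \prod_(e <- s | e.2 == v) (u == e.1)%:R); last first.
  rewrite bigA_distr_bigA; apply: eq_bigr => p _; rewrite big_split /=.
  congr (_ * _); rewrite (exchange_big_dep xpredT) //= -prod_indicator.
  by apply: eq_bigr => e _; rewrite (big_pred1 e.2) // => v; rewrite eq_sym.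
elim: s uniq_heads => [|e s IHs] /=.
  rewrite big_nil => _; rewrite big1 // => v _; rewrite -[RHS](q_sum1 v).
  by apply: eq_bigr => u _; rewrite big_nil mulr1.
case/andP=> e2_notin /IHs {}IHs.
have no_arc u : \prod_(e' <- s | e'.2 == e.2) (u == e'.1)%:R = 1 :> R.
  rewrite big_seq_cond big1 // => e' /andP[e's /eqP e'2].
  by rewrite -e'2 map_f in e2_notin.
rewrite big_cons IHs (bigD1 e.2) //= [RHS](bigD1 e.2) //=; congr (_ * _).
- rewrite (bigD1 e.1) //= big_cons !eqxx no_arc !mulr1 big1 ?addr0 // => u.
  by move=> /negbTE ne; rewrite big_cons eqxx ne mul0r mulr0.
- under eq_bigr do rewrite no_arc mulr1.
  rewrite q_sum1 mul1r; apply: eq_bigr => v /negbTE ne.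
  by apply: eq_bigr => u _; rewrite big_cons eq_sym ne.
Qed.

End RandomParent.

(** * Paths in a forest *)

Lemma uniq_iota_mod (a k : nat) : uniq [seq (i %% k)%N | i <- iota a k].
Proof.
rewrite map_inj_in_uniq ?iota_uniq // => i j.
wlog le_ij : i j / (i <= j)%N => [hyp|].
  have [/hyp //|/ltnW ji] := leqP i j => ii jj /esym e; exact/esym/hyp.
rewrite !mem_iota => ii jj /eqP; rewrite eq_sym eqn_mod_dvd // => /dvdnP[m].
by case: m => [|m] E; lia.
Qed.

(** [p] is the parent function of the forest and [h] the depth.  Vertices with
    [d v = 0] behave as roots: [p v] is then arbitrary, and the step condition
    on the depth is only asked of the other vertices. *)
Section Forest.

Variables (R : numDomainType) (V : finType) (d : V -> R) (p : V -> V).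
Variable h : V -> nat.
Hypothesis d_ge0 : forall v, 0 <= d v.
Hypothesis h_step : forall v, d v != 0 -> h v = (h (p v)).+1.

Let down : rel V := [rel u v | p v == u].

Lemma down_path_depth (x : V) (s : seq V) :
  path down x s -> all (fun v => d v != 0) s ->
  map h s = iota (h x).+1 (size s).
Proof.
elim: s x => //= y s IHs x /andP[/eqP pyx ps] /andP[dy ds].
by rewrite (h_step dy) pyx (IHs y) // (h_step dy) pyx.
Qed.

(** Consecutive depths hit every residue modulo [k] once, so the heads of the
    path can be listed as a choice [g] of one vertex of each colour. *)
Lemma down_path_rainbow (k : nat) (x : V) (s : seq V) :
  (0 < k)%N -> path down x s -> all (fun v => d v != 0) s -> size s = k ->
  exists2 g : {ffun 'I_k -> V},
    forall c, (h (g c) %% k)%N = c & perm_eq s (codom g).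
Proof.
move=> k_gt0 ps ds sz_s.
pose color v := (h v %% k)%N.
have uniq_col : uniq (map color s).
  have := uniq_iota_mod (h x).+1 k.
  by rewrite -[in iota _ _]sz_s -(down_path_depth ps ds) -map_comp.
have [_ all_col] : (size (map color s) = size (iota 0 k)) *
    (map color s =i iota 0 k).
  apply: uniq_min_size => //; last by rewrite size_map size_iota sz_s.
  by move=> _ /mapP[v _ ->]; rewrite mem_iota /= ltn_mod.
have has_col (c : 'I_k) : has (fun v => color v == c) s.
  have : (c : nat) \in map color s by rewrite all_col mem_iota /=.
  by case/mapP=> v vs ->; apply/hasP; exists v.
exists [ffun c : 'I_k => nth x s (find (fun v => color v == c) s)].
  by move=> c; rewrite ffunE; exact/eqP/(nth_find x (has_col c)).
set g := finfun _.
have g_col c : color (g c) = c by rewrite ffunE; exact/eqP/(nth_find x (has_col c)).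
have g_inj : injective g by move=> c c' E; apply: val_inj; rewrite /= -!g_col E.
have uniq_g : uniq (codom g) by exact/injectiveP.
have uniq_s : uniq s := map_uniq uniq_col.
rewrite perm_sym; apply: uniq_perm => //.
apply: (uniq_min_size uniq_g _ _).2; last by rewrite size_codom card_ord sz_s.
by move=> _ /codomP[c ->]; rewrite ffunE mem_nth // -has_find has_col.
Qed.

(** Expanding the right-hand side gives one monomial for each choice of a vertex
    of each colour.  The choice attached to a path determines it: the depth
    orders the heads, and the first vertex is the parent of the first head. *)
Lemma down_path_sum_le (k : nat) : (0 < k)%N ->
  \sum_(t : k.+1.-tuple V | sorted down t) \prod_(v <- behead t) d v
    <= \prod_(c < k) \sum_(v | (h v %% k)%N == c) d v.
Proof.
move=> k_gt0.
(* Paths with a head of weight 0 contribute nothing and may escape the colouring. *)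
pose live (t : k.+1.-tuple V) :=
  sorted down t && all (fun v => d v != 0) (behead t).
pose rainbow (t : k.+1.-tuple V) (g : {ffun 'I_k -> V}) :=
  [forall c, (h (g c) %% k)%N == c] && perm_eq (behead t) (codom g).
pose phi t := odflt [ffun=> thead t] [pick g | rainbow t g].
have phiP t : live t -> rainbow t (phi t).
  move=> /andP[]; rewrite /phi; case: pickP => [g //|no_g].
  case/tupleP: t no_g => x s no_g /= ps ds.
  have [g g_col g_perm] := down_path_rainbow k_gt0 ps ds (size_tuple s).
  by move: (no_g g); rewrite /rainbow /= g_perm andbT => /forallP[] c; apply/eqP.
have phi_inj : {in live &, injective phi}.
  move=> t t' lt lt' eq_phi.
  have /andP[_ pt] := phiP _ lt; have /andP[_ pt'] := phiP _ lt'.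
  have eq_mem : behead t =i behead t'.
    by apply: perm_mem; rewrite (permPl pt) eq_phi perm_sym.
  case/tupleP: t lt eq_mem {pt eq_phi} => x s /andP[/= ps ds].
  case/tupleP: t' lt' {pt'} => x' s' /andP[/= ps' ds'] eq_mem.
  have by_depth y (r : seq V) : path down y r -> all (fun v => d v != 0) r ->
      sorted [rel u v | h u < h v]%N r.
    move=> pr dr; have : sorted ltn (map h r).
      by rewrite (down_path_depth pr dr) iota_ltn_sorted.
    by rewrite sorted_map.
  have eq_s : s = s' :> seq V.
    apply: (@irr_sorted_eq _ [rel u v | h u < h v]%N) => //.
    - by move=> u v w; apply: ltn_trans.
    - by move=> u; apply: ltnn.
    - exact: by_depth ps ds.
    - exact: by_depth ps' ds'.
  apply: val_inj => /=; rewrite -eq_s; congr (_ :: _).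
  rewrite -eq_s in ps'; have := size_tuple s.
  case: (tval s) ps ps' => [|y r] /=; first by move=> _ _ k0; rewrite -k0 in k_gt0.
  by case/andP=> /eqP <- _ /andP[/eqP <-].
rewrite bigA_distr_big_dep.
apply: (@le_trans _ _ (\sum_(t in live) \prod_(c < k) d (phi t c))).
  rewrite big_mkcond [leRHS]big_mkcond; apply: ler_sum => t _ /=.
  rewrite unfold_in /live; case: ifP => //= st; case: ifP => [dt|/allPn[v vt]].
    have /phiP/andP[_ pt] : live t by rewrite /live st.
    by rewrite (perm_big _ pt) big_image.
  by rewrite negbK => /eqP dv; rewrite (big_rem v) //= dv mul0r.
rewrite -(big_imset (fun g : {ffun 'I_k -> V} => \prod_(c < k) d (g c)) phi_inj) /=.
rewrite big_mkcond [leRHS]big_mkcond; apply: ler_sum => g _ /=.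
case: ifP => [/imsetP[t lt ->]|_].
  suff -> : phi t \in family (fun c : 'I_k => fun v => (h v %% k == c)%N) by [].
  by apply/familyP => c; have /andP[/forallP/(_ c)] := phiP _ lt.
by case: ifP => // _; apply: prodr_ge0.
Qed.

End Forest.

(** The depth counts the steps to the parent until a vertex outside [live] is
    reached. *)
Lemma depth_exists (V : finType) (live : pred V) (p : V -> V) (rk : V -> nat) :
  (forall v, live v -> rk (p v) < rk v)%N ->
  exists h : V -> nat, forall v, live v -> h v = (h (p v)).+1.
Proof.
move=> rk_p.
(* [n] is fuel; it suffices that it exceed the rank. *)
pose fix h (n : nat) (v : V) {struct n} : nat := if n is m.+1 then
  if live v then (h m (p v)).+1 else 0%N else 0%N.
have stable n m v : (rk v < n)%N -> (rk v < m)%N -> h n v = h m v.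
  elim: n m v => [|n IHn] [|m] v //= vn vm; case: ifP => // /rk_p lt.
  by rewrite (IHn m) //; apply: leq_trans lt _.
exists (fun v => h (rk v).+1 v) => v lv.
transitivity (h (rk v) (p v)).+1; first by rewrite /= lv.
by congr _.+1; apply: stable; rewrite ?rk_p.
Qed.

(** * The bound on the walk sum *)

Section WalkSum.

Variables (R : realFieldType) (V : finType) (A : V -> V -> R).
Variable rk : V -> nat.
Hypothesis A_ge0 : forall u v, 0 <= A u v.
Hypothesis rk_lt : forall u v, A u v != 0 -> (rk u < rk v)%N.

(** Some value of a random variable is at least its expectation; quantifying
    over an upper bound [B] of the products for all colourings avoids naming the
    forest that reaches it. *)
Lemma walk_sum_le (k : nat) (B : R) : (0 < k)%N ->
  (forall col : V -> 'I_k,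
     \prod_(c < k) \sum_(v | col v == c) \sum_u A u v <= B) ->
  walk_sum A k <= B.
Proof.
move=> k_gt0 le_B.
pose d v := \sum_u A u v.
have d_ge0 v : 0 <= d v by apply: sumr_ge0.
(* A vertex without incoming weight must choose some parent; it chooses itself. *)
pose q v u := if d v == 0 then (u == v)%:R else A u v / d v.
have q_ge0 v u : 0 <= q v u.
  by rewrite /q; case: ifP => _; rewrite ?ler0n // divr_ge0.
have q_sum1 v : \sum_u q v u = 1.
  rewrite /q; case: eqP => [_|/eqP dv]; last by rewrite -mulr_suml divff.
  rewrite (bigD1 v) //= eqxx big1 ?addr0 // => u /negbTE -> //.
have A_dq u v : A u v = d v * q v u.
  rewrite /q; case: eqP => [dv|/eqP dv]; last by rewrite mulrC divfK.
  by rewrite dv mul0r; apply/eqP; rewrite (psumr_eq0P _ dv).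
pose prob (p : {ffun V -> V}) := \prod_v q v (p v).
have prob_sum1 : \sum_p prob p = 1.
  by rewrite -bigA_distr_bigA big1 // => v _.
pose down (p : {ffun V -> V}) : rel V := [rel u v | p v == u].
pose f (p : {ffun V -> V}) :=
  \sum_(t : k.+1.-tuple V | sorted (down p) t) \prod_(v <- behead t) d v.
pose rising (t : seq V) := sorted [rel u v | A u v != 0] t.
have rising_uniq t : rising t -> uniq t.
  move=> rt; apply: (@sorted_uniq _ [rel u v | rk u < rk v]%N).
  - by move=> u v w; apply: ltn_trans.
  - by move=> u; apply: ltnn.
  - by apply: sub_sorted rt => u v /= /rk_lt.
(* This is an equality on rising walks; the others have content 0. *)
have content_le t : walk_content A t <=
    \sum_p prob p * ((sorted (down p) t)%:R * \prod_(v <- behead t) d v).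
  have [rt|nrt] := boolP (rising t); last first.
    apply: (@le_trans _ _ 0); last first.
      apply: sumr_ge0 => p _; rewrite !mulr_ge0 ?ler0n ?prodr_ge0 // => v _ //.
    move: nrt; rewrite /rising sorted_arcs => /allPn[e te /negPn/eqP Ae].
    by rewrite /walk_content (big_rem e) //= Ae mul0r.
  have ut : uniq (unzip2 (zip t (behead t))).
    by rewrite arc_heads; case: (t) (rising_uniq _ rt) => //= x s /andP[].
  rewrite /walk_content (eq_bigr _ (fun e _ => A_dq e.1 e.2)) big_split /=.
  rewrite (prod_arcs_expectation q_sum1 ut) mulrC mulr_suml.
  rewrite -[in X in X <= _](big_map snd xpredT d) [map _ _]arc_heads.
  by apply: ler_sum => p _; rewrite sorted_arcs mulrA.
have -> : B = \sum_p prob p * B by rewrite -mulr_suml prob_sum1 mul1r.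
apply: (@le_trans _ _ (\sum_p prob p * f p)).
  rewrite /walk_sum.
  apply: le_trans (ler_sum _ (fun t _ => content_le (tval t))) _.
  rewrite exchange_big /=; apply: ler_sum => p _.
  rewrite -mulr_sumr ler_wpM2l ?prodr_ge0 // /f [leRHS]big_mkcond.
  by apply: ler_sum => t _; case: ifP; rewrite ?mul1r ?mul0r.
apply: ler_sum => p _.
have [->|prob_n0] := eqVneq (prob p) 0; first by rewrite !mul0r.
rewrite ler_wpM2l ?prodr_ge0 //.
have rk_p v : d v != 0 -> (rk (p v) < rk v)%N.
  move=> dv; apply: rk_lt; apply: contraNneq prob_n0 => Apv.
  by rewrite /prob (bigD1 v) //= /q (negbTE dv) Apv !mul0r.
(* A parent function of positive probability follows edges of [A], so that the
   rank makes it a forest. *)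
have [h h_step] := depth_exists rk_p.
apply: le_trans (down_path_sum_le d_ge0 h_step k_gt0) _.
exact: le_B (fun v => Ordinal (ltn_pmod (h v) k_gt0)).
Qed.

End WalkSum.

(** * Acyclicity and ranks *)

(** The number of ancestors of a vertex grows strictly along the edges. *)
Lemma acyclic_rank (V : finType) (e : rel V) :
  (forall c, c != [::] -> ~~ cycle e c) ->
  exists rk : V -> nat, forall u v, e u v -> (rk u < rk v)%N.
Proof.
move=> acyc; exists (fun v => #|[pred u | connect e u v]|) => u v euv.
apply/proper_card/properP; split.
  apply/fintype.subsetP => w; rewrite !inE => /connect_trans; apply; exact: connect1.
exists v; rewrite !inE ?connect0 //.
apply/negP => /connectP[p pvp u_last].
by have := acyc (v :: p) isT; rewrite /= rcons_path pvp -u_last euv.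
Qed.

Lemma rank_acyclic (V : eqType) (e : rel V) (rk : V -> nat) :
  (forall u v, e u v -> (rk u < rk v)%N) ->
  forall c, c != [::] -> ~~ cycle e c.
Proof.
move=> rk_lt [//|x p] _; apply/negP => /= cyc.
have tr : transitive [rel u v | rk u < rk v]%N by move=> u v w; apply: ltn_trans.
have : path [rel u v | rk u < rk v]%N x (rcons p x) by apply: sub_path cyc.
by move/(order_path_min tr)/allP/(_ x); rewrite /= mem_rcons mem_head ltnn => /(_ isT).
Qed.

(** * Powers of label matrices *)

Lemma big_tuple_cons (R : nmodType) (T : finType) (n : nat)
    (F : seq T -> R) :
  \sum_(t : n.+1.-tuple T) F t = \sum_x \sum_(s : n.-tuple T) F (x :: s).
Proof.
rewrite pair_big /= (reindex (fun xs : T * n.-tuple T => cons_tuple xs.1 xs.2)) //.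
exists (fun t => (thead t, [tuple of behead t])) => [[x s] _|t _] /=.
  by rewrite theadE; congr pair; apply: val_inj.
by rewrite [RHS]tuple_eta; apply: val_inj.
Qed.

(** The indices of the matrix are related to the vertices by a bijection [f], so
    that one computation serves for an abstract vertex set, enumerated by [f],
    and for the indices of a given matrix, with [f] the identity. *)
Section MatrixPowers.

Variables (R : comPzSemiRingType) (V : finType) (L : V -> V -> R) (n : nat).
Variable f : 'I_n -> V.
Hypothesis f_bij : bijective f.

Let A : 'M[R]_n := \matrix_(i, j) L (f i) (f j).

Lemma row_sum_expmx (k : nat) (i : 'I_n) :
  \sum_j (A ^+ k) i j = \sum_(s : k.-tuple V) walk_content L (f i :: s).
Proof.
elim: k i => [|k IHk] i.
  rewrite (big_pred1 [tuple]) => [|s]; last by apply/esym/eqP; exact: tuple0.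
  rewrite /walk_content big_nil (bigD1 i) //= expr0 mxE eqxx big1 ?addr0 // => j.
  by rewrite eq_sym mxE => /negbTE ->.
under eq_bigr do rewrite exprS -mulmxE mxE.
rewrite exchange_big (big_tuple_cons _ (fun s => walk_content L (f i :: s))).
rewrite (reindex f) /=; last exact: onW_bij.
apply: eq_bigr => l _; rewrite -mulr_sumr IHk mxE mulr_sumr.
by apply: eq_bigr => s _; rewrite walk_content_cons2.
Qed.

Lemma sum_expmx (k : nat) : \sum_i \sum_j (A ^+ k) i j = walk_sum L k.
Proof.
rewrite /walk_sum (big_tuple_cons _ (walk_content L)) (reindex f) /=.
  by apply: eq_bigr => i _; rewrite row_sum_expmx.
exact: onW_bij.
Qed.

(** A nonzero entry of the [k]-th power comes from a walk of [k] edges, each of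
    which raises the rank. *)
Lemma expmx_rank (rk : V -> nat) :
  (forall u v, L u v != 0 -> (rk u < rk v)%N) ->
  forall k i j, (A ^+ k) i j != 0 -> (rk (f i) + k <= rk (f j))%N.
Proof.
move=> rk_lt; elim=> [|k IHk] i j.
  by rewrite expr0 mxE addn0; have [->|_] := eqVneq i j; rewrite ?eqxx.
rewrite exprS -mulmxE mxE => sum_n0.
have [l /andP[Ail Alj]] : exists l, (A i l != 0) && ((A ^+ k) l j != 0).
  apply/existsP; apply: contraNT sum_n0; rewrite negb_exists => /forallP no_l.
  rewrite big1 // => l _; have := no_l l; rewrite negb_and !negbK.
  by case/orP=> /eqP ->; rewrite ?mul0r ?mulr0.
apply: leq_trans (IHk _ _ Alj); rewrite addnS -addSn leq_add2r.
by apply: rk_lt; rewrite mxE in Ail.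
Qed.

Lemma nilpotent_of_rank (rk : V -> nat) :
  (forall u v, L u v != 0 -> (rk u < rk v)%N) -> exists m, A ^+ m = 0.
Proof.
move=> rk_lt; exists (\max_v rk v).+1; apply/matrixP => i j; rewrite mxE.
apply/eqP/negPn/negP => /(expmx_rank rk_lt).
by rewrite addnS ltnNge (leq_trans (leq_bigmax (f j))) // leq_addl.
Qed.

End MatrixPowers.

Section NonnegMatrix.

Variables (R : numDomainType) (n : nat).
Implicit Types A B : 'M[R]_n.

Lemma expmx_ge0 A (m : nat) : (forall i j, 0 <= A i j) ->
  forall i j, 0 <= (A ^+ m) i j.
Proof.
move=> A_ge0; elim: m => [|m IHm] i j; first by rewrite expr0 mxE ler0n.
by rewrite exprS -mulmxE mxE sumr_ge0 // => l _; rewrite mulr_ge0.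
Qed.

Lemma mulmx_entry_gt0 A B i l j :
  (forall i j, 0 <= A i j) -> (forall i j, 0 <= B i j) ->
  0 < A i l -> 0 < B l j -> 0 < (A * B) i j.
Proof.
move=> A_ge0 B_ge0 Ail Blj; rewrite -mulmxE mxE (bigD1 l) //=.
by rewrite ltr_pwDl ?mulr_gt0 // sumr_ge0 // => l' _; rewrite mulr_ge0.
Qed.

(** Without cancellation, a cycle of length [l] through [x] makes the diagonal
    entry at [x] of every power of [A ^+ l] positive. *)
Lemma nilpotent_acyclic A (m : nat) : (forall i j, 0 <= A i j) -> A ^+ m = 0 ->
  forall c, c != [::] -> ~~ cycle (fun i j => A i j != 0) c.
Proof.
move=> A_ge0 Am0 [//|x p] _; apply/negP => /= cyc.
have path_gt0 y s : path (fun i j => A i j != 0) y s ->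
    0 < (A ^+ size s) y (last y s).
  elim: s y => [|z s IHs] y /=; first by rewrite expr0 mxE eqxx ltr01.
  case/andP=> Ayz /IHs gt0; rewrite exprS.
  apply: mulmx_entry_gt0 gt0 => //; first exact: expmx_ge0.
  by rewrite lt0r Ayz A_ge0.
have := path_gt0 _ _ cyc; rewrite last_rcons size_rcons.
set C := A ^+ _ => Cxx.
have C_ge0 : forall i j, 0 <= C i j by exact: expmx_ge0.
have Cexp_gt0 r : 0 < (C ^+ r) x x.
  elim: r => [|r IHr]; first by rewrite expr0 mxE eqxx ltr01.
  by rewrite exprS; apply: mulmx_entry_gt0 IHr => //; exact: expmx_ge0.
by have := Cexp_gt0 m; rewrite -exprM mulnC exprM Am0 expr0n /= mxE ltxx.
Qed.

End NonnegMatrix.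

(** * The three sets of values *)

Lemma walk_content_iota (R : pzSemiRingType) (V : Type) (A : V -> V -> R)
    (f : nat -> V) (m k : nat) :
  walk_content A (map f (iota m k.+1)) = \prod_(i <- iota m k) A (f i) (f i.+1).
Proof.
elim: k m => [|k IHk] m; first by rewrite /walk_content !big_nil.
by rewrite [LHS]walk_content_cons2 (IHk m.+1) big_cons.
Qed.

Local Open Scope classical_set_scope.

Section Submonoid.

Variables (R : realType) (M : set R) (N : R).
Hypothesis M_sub : closed_submonoid M.

Lemma submonoid_ge0 x : M x -> 0 <= x.
Proof. by case: M_sub => _ ge0 _ _; apply: ge0. Qed.

Lemma submonoid_sum (I : Type) (r : seq I) (P : pred I) (F : I -> R) :
  (forall i, P i -> M (F i)) -> M (\sum_(i <- r | P i) F i).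
Proof. by case: M_sub => _ _ M0 MD MF; apply: big_ind. Qed.

(** The tuples of elements of [M] with sum [N] form a closed subset of the cube
    [[0, N]^k], on which the product is continuous. *)
Lemma product_values_has_maximum (k : nat) : (0 < k)%N -> M N ->
  exists v, is_maximum (product_values M N k) v.
Proof.
case: k => // k _ N_in.
pose S := [set v : 'rV[R]_k.+1 | forall i, M (v ord0 i)] `&`
  [set v : 'rV[R]_k.+1 | \sum_i v ord0 i = N].
have coord i : continuous (fun v : 'rV[R]_k.+1 => v ord0 i).
  exact: coord_continuous.
have S_closed : closed S.
  apply: closedI.
    have -> : [set v : 'rV[R]_k.+1 | forall i, M (v ord0 i)] =
        \bigcap_(i in setT) ((fun v : 'rV[R]_k.+1 => v ord0 i) @^-1` M).
      by apply/seteqP; split => v /= Mv => [i _|i]; apply: Mv.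
    apply: closed_bigI => i _; apply: preimage_closed; last by case: M_sub.
    by move=> v _; apply: coord.
  apply: (@preimage_closed _ _ (fun v : 'rV[R]_k.+1 => \sum_i v ord0 i) [set N]).
    by move=> v _; apply: continuous_big => //; exact: add_continuous.
  exact: closed_eq.
have S_compact : compact S.
  have box : compact [set v : 'rV[R]_k.+1 | forall i, `[0, N]%classic (v ord0 i)].
    apply: (@rV_compact R k.+1 (fun=> `[0, N]%classic)) => i.
    exact: segment_compact.
  apply: (subclosed_compact S_closed box).
  move=> v [Mv sum_v] i /=; rewrite in_itv /= submonoid_ge0 //= -sum_v.
  by rewrite (bigD1 i) //= lerDl sumr_ge0 // => j _; apply: submonoid_ge0.
have S_n0 : S !=set0.
  exists (\row_i (if i == ord0 then N else 0)); split.
    by move=> i; rewrite mxE; case: M_sub => _ _ M0 _; case: ifP.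
  rewrite /= (bigD1 ord0) //= mxE eqxx big1 ?addr0 // => i /negbTE ne.
  by rewrite mxE ne.
have [] := @EVT_max_rV _ _ (fun v => \prod_i v ord0 i) S S_n0 S_compact.
  apply: continuous_subspaceT => v.
  by apply: continuous_big => //; exact: mul_continuous.
move=> c /set_mem[Mc sum_c] c_max; exists (\prod_i c ord0 i); split.
  by exists (c ord0); split => // i; exact: submonoid_ge0.
move=> _ [x [Mx _ sum_x ->]].
have := c_max (\row_i x i); rewrite (eq_bigr x) => [|i _]; last by rewrite mxE.
apply; apply/mem_set; split => [i|]; first by rewrite mxE.
by rewrite -sum_x; apply: eq_bigr => i _; rewrite mxE.
Qed.

Definition support_digraph (V : finType) (L : V -> V -> R)
    (L_in : forall u v, M (L u v)) : labeled_digraph M :=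
  @LabeledDigraph R M V (fun u v => L u v != 0) L L_in
    (fun u v => esym (negbK (L u v == 0))).

Lemma edgeE (G : labeled_digraph M) (u v : vertex G) :
  edge u v = (label u v != 0).
Proof. by rewrite label_eq0 negbK. Qed.

Lemma graph_weightE (G : labeled_digraph M) :
  graph_weight G = \sum_(u : vertex G) \sum_v label u v.
Proof.
rewrite /graph_weight pair_big /= big_mkcond; apply: eq_bigr => -[u v] _ /=.
by rewrite edgeE; case: eqP.
Qed.

Lemma path_content_sumE (G : labeled_digraph M) (k : nat) :
  path_content_sum k G = walk_sum (@label _ _ G) k.
Proof.
rewrite /path_content_sum big_mkcond; apply: eq_bigr => t _.
case: ifP => // /negbT; rewrite sorted_arcs => /allPn[e te].
by rewrite edgeE negbK => /eqP Le; rewrite /walk_content (big_rem e) //= Le mul0r.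
Qed.

Lemma acyclic_label_rank (G : labeled_digraph M) : acyclic G ->
  exists rk : vertex G -> nat,
    forall u v, label u v != 0 -> (rk u < rk v)%N.
Proof. by move/acyclic_rank=> [rk rk_lt]; exists rk => u v; rewrite -edgeE; apply: rk_lt. Qed.

Lemma dag_nilpotent_values (k : nat) :
  dag_values M N k = nilpotent_values M N k.
Proof.
apply/seteqP; split => v.
  move=> [G [/acyclic_label_rank[rk rk_lt] weightG ->]].
  have f_bij := @enum_val_bij (vertex G).
  exists #|vertex G|, (\matrix_(i, j) label (enum_val i) (enum_val j)); split.
  - by move=> i j; rewrite mxE; apply: label_in.
  - exact: (nilpotent_of_rank enum_val rk_lt).
  - rewrite -weightG graph_weightE (reindex _ (onW_bij _ f_bij)) /=.
    apply: eq_bigr => i _; rewrite (reindex _ (onW_bij _ f_bij)) /=.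
    by apply: eq_bigr => j _; rewrite mxE.
  - by rewrite path_content_sumE /mx_weight sum_expmx.
move=> [n [A [A_in [m Am0] weightA ->]]].
exists (support_digraph A_in); split.
- by apply: (nilpotent_acyclic _ Am0) => i j; apply: submonoid_ge0.
- by rewrite graph_weightE.
- have id_bij : bijective (@id 'I_n) by exists id.
  have A_eq : \matrix_(i, j) A (id i) (id j) = A.
    by apply/matrixP => i j; rewrite mxE.
  by rewrite path_content_sumE -[in LHS]A_eq /mx_weight sum_expmx.
Qed.

Lemma dag_value_le_product (k : nat) (v : R) : (0 < k)%N ->
  is_maximum (product_values M N k) v -> ubound (dag_values M N k) v.
Proof.
move=> k_gt0 [_ v_max] _ [G [/acyclic_label_rank[rk rk_lt] weightG ->]].
rewrite path_content_sumE; apply: (walk_sum_le _ rk_lt k_gt0).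
  by move=> x y; apply: submonoid_ge0; apply: label_in.
move=> col; apply: v_max.
exists (fun c => \sum_(y | col y == c) \sum_x label x y).
have in_M c : M (\sum_(y | col y == c) \sum_x label x y).
  by do 2!apply: submonoid_sum => ? _; apply: label_in.
split=> // [c|]; first exact: submonoid_ge0.
by rewrite -weightG graph_weightE [RHS]exchange_big [RHS](partition_big col xpredT).
Qed.

(** The digraph is a directed path on [k.+1] vertices with labels [x].  An
    inequality suffices when [x] has maximal product, which spares showing that
    the path is the only one of its length. *)
Lemma product_le_dag_value (k : nat) (v : R) :
  product_values M N k v -> exists2 w, dag_values M N k w & v <= w.
Proof.
move=> [x [x_in x_ge0 sum_x ->]].
(* The sum has at most one term; it is [x i] when [j] is the successor of [i]. *)
pose L (i j : 'I_k.+1) :=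
  \sum_(c < k | (i == c :> nat) && (j == c.+1 :> nat)) x c.
have L_in i j : M (L i j) by apply: submonoid_sum.
have L_rank (i j : 'I_k.+1) : L i j != 0 -> (i < j)%N.
  apply: contraNT => ij; rewrite /L big_pred0 // => c.
  by apply: contraNF ij => /andP[/eqP -> /eqP ->].
exists (path_content_sum k (support_digraph L_in)).
  exists (support_digraph L_in); split => //.
    exact: (rank_acyclic L_rank).
  rewrite graph_weightE -sum_x /= pair_big /= /L.
  rewrite (exchange_big_dep xpredT) //=; apply: eq_bigr => c _.
  by rewrite (big_pred1 (widen_ord (leqnSn k) c, lift ord0 c)).
rewrite path_content_sumE /walk_sum.
have size_t : size (map (@inord k) (iota 0 k.+1)) == k.+1.
  by rewrite size_map size_iota.
rewrite (bigD1 (Tuple size_t)) //= walk_content_iota.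
have -> : \prod_(i <- iota 0 k) L (inord i) (inord i.+1) = \prod_i x i.
  rewrite -[k in iota 0 k]subn0 big_mkord; apply: eq_bigr => c _.
  rewrite /L (big_pred1 c) // => c'; rewrite !inordK ?ltnS //; last exact: ltnW.
  by rewrite eqSS andbb eq_sym.
by rewrite lerDl sumr_ge0 // => t _; apply: walk_content_ge0 => i j; exact: submonoid_ge0.
Qed.

End Submonoid.

Theorem theorem2p4 (R : realType) (k : nat) (M : set R) (N : R)
    (k_gt0 : (0 < k)%N) (M_closed : closed_submonoid M) (N_in : M N) :
  exists v : R,
    [/\ is_maximum (dag_values M N k) v,
        is_maximum (nilpotent_values M N k) v
      & is_maximum (product_values M N k) v].
Proof.
have [v v_max] := product_values_has_maximum M_closed k_gt0 N_in.
have dag_le := dag_value_le_product M_closed k_gt0 v_max.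
have [w w_dag v_le_w] := product_le_dag_value M_closed v_max.1.
have dag_max : is_maximum (dag_values M N k) v.
  by split=> //; rewrite (@le_anti _ _ v w) // v_le_w dag_le.
by exists v; split; rewrite -?dag_nilpotent_values.
Qed.
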